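(* Consider the family of $E_7$-type fibrations $y^2=x^4+e\,x^2z^2+f\,xz^3+g\,z^4$, depending on a scalar parameter $C$, given by $$e=-2h,\qquad f=C\phi,\qquad g=h^2+C\gamma,$$ with $h,\phi,\gamma$ general sections of $\mathscr L^2,\mathscr L^3,\mathscr L^4$ over the base $B$. Then, up to nonzero numerical constants and at leading order in $C$ as $C\to0$, the discriminant $\Delta$ and the $j$-invariant satisfy $$\Delta\sim C^2\,h^2(\gamma^2-\phi^2h),\qquad j\sim\frac1{C^2}\cdot\frac{h^4}{\gamma^2-\phi^2h}.$$
   Context: $\mathscr L$ is a line bundle on a nonsingular compact complex variety $B$. The Weierstrass model of the curve $y^2=x^4+e\,x^2z^2+f\,xz^3+g\,z^4$ is $y^2+x^3+Fx+G=0$ with $F=-4g-\frac13e^2$ and $G=-f^2+\frac83eg-\frac2{27}e^3$; its discriminant is $\Delta=4F^3+27G^2$ and its $j$-invariant is, up to a nonzero constant factor, $F^3/\Delta$. ''$\Delta\sim C^2A$ at leading order in $C$'' means that $\Delta$, as a polynomial in $C$, has the form (nonzero constant)$\,\cdot C^2A+O(C^3)$, and the statement for $j$ is understood as the quotient of the leading terms of $F^3$ and $\Delta$. *)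

(* Defs.v *)
From HB Require Import structures.
From mathcomp Require Import all_boot all_order all_algebra complex.
From mathcomp Require Import all_classical all_reals all_analysis.
Import Order.TTheory GRing.Theory Num.Theory numFieldNormedType.Exports.

Set Implicit Arguments.
Unset Strict Implicit.
Unset Printing Implicit Defensive.

Local Open Scope classical_set_scope.
Local Open Scope ring_scope.

(* Typing [R[i]] as a [numFieldType] gives it its canonical topology and makes
   ['rV[CC R]_n] a normed module over it, so that [differentiable] for maps
   ['rV[CC R]_n -> CC R] is complex (Frechet) differentiability, i.e.
   holomorphy. *)
Definition CC (R : realType) : numFieldType := R[i].

(* A connected compact complex manifold of dimension [n].  Charts and their
   inverses are total functions, meaningful only on the indicated domains. *)
Record compactComplexManifold (R : realType) (n : nat) (B : topologicalType) :=
  CompactComplexManifold {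
  chart_idx : Type;
  chart_dom : chart_idx -> set B;
  chart : chart_idx -> B -> 'rV[CC R]_n;
  chart_inv : chart_idx -> 'rV[CC R]_n -> B;
  chart_dom_open : forall a, open (chart_dom a);
  chart_cover : forall x, exists a, chart_dom a x;
  chart_img_open : forall a, open (chart a @` chart_dom a);
  chartK : forall a x, chart_dom a x -> chart_inv a (chart a x) = x;
  chart_cont : forall a, {within chart_dom a, continuous (chart a)};
  chart_inv_cont : forall a,
    {within chart a @` chart_dom a, continuous (chart_inv a)};
  chart_compat : forall a b x, chart_dom a x -> chart_dom b x ->
    differentiable (chart b \o chart_inv a) (chart a x);
  manifold_hausdorff : hausdorff_space B;
  manifold_compact : compact [set: B];
  manifold_connected : connected [set: B];
  manifold_nonempty : [set: B] !=set0 }.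

Section Bundles.
Variables (R : realType) (n : nat) (B : topologicalType).
Variable M : compactComplexManifold R n B.

(* Intended for [A] open. *)
Definition holomorphic_on (A : set B) (f : B -> CC R) : Prop :=
  forall (a : chart_idx M) x, A x -> chart_dom a x ->
    differentiable (f \o chart_inv a) (chart a x).

Lemma holomorphic_on_cst A c : holomorphic_on A (fun=> c).
Proof. by move=> a x _ _; exact: differentiable_cst. Qed.

Lemma holomorphic_onD A f g : holomorphic_on A f -> holomorphic_on A g ->
  holomorphic_on A (fun x => f x + g x).
Proof.
by move=> hf hg a x Ax ax; exact: differentiableD (hf _ _ Ax ax) (hg _ _ Ax ax).
Qed.

Lemma holomorphic_onM A f g : holomorphic_on A f -> holomorphic_on A g ->
  holomorphic_on A (fun x => f x * g x).
Proof.
by move=> hf hg a x Ax ax; exact: differentiableM (hf _ _ Ax ax) (hg _ _ Ax ax).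
Qed.

Lemma holomorphic_onX A f k : holomorphic_on A f ->
  holomorphic_on A (fun x => f x ^+ k).
Proof.
move=> hf; elim: k => [|k IHk].
  by under [X in holomorphic_on _ X]eq_fun do rewrite expr0;
     exact: holomorphic_on_cst.
by under [X in holomorphic_on _ X]eq_fun do rewrite exprS; exact: holomorphic_onM.
Qed.

(* A holomorphic line bundle, given by a trivializing open cover and a cocycle
   of nowhere vanishing holomorphic transition functions. *)
Record lineBundle := LineBundle {
  lb_idx : Type;
  lb_dom : lb_idx -> set B;
  lb_trans : lb_idx -> lb_idx -> B -> CC R;
  lb_open : forall i, open (lb_dom i);
  lb_cover : forall x, exists i, lb_dom i x;
  lb_holo : forall i j, holomorphic_on (lb_dom i `&` lb_dom j) (lb_trans i j);
  lb_neq0 : forall i j x, lb_dom i x -> lb_dom j x -> lb_trans i j x != 0;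
  lb_cocycle : forall i j k x, lb_dom i x -> lb_dom j x -> lb_dom k x ->
    lb_trans i j x * lb_trans j k x = lb_trans i k x }.

(* A holomorphic section, given by its expressions in the local
   trivializations; [sec s i x] is meaningful only for [lb_dom i x]. *)
Record section (L : lineBundle) := Section_ {
  sec :> lb_idx L -> B -> CC R;
  sec_holo : forall i, holomorphic_on (lb_dom i) (sec i);
  sec_glue : forall i j x, lb_dom i x -> lb_dom j x ->
    sec i x = lb_trans i j x * sec j x }.

Definition sec_eq (L : lineBundle) (s t : section L) : Prop :=
  forall i x, lb_dom i x -> s i x = t i x.

Definition sec_nonzero (L : lineBundle) (s : section L) : Prop :=
  exists i x, lb_dom i x /\ s i x != 0.

Fact lbpow_holo (L : lineBundle) k (i j : lb_idx L) :
  holomorphic_on (lb_dom i `&` lb_dom j) (fun x => lb_trans i j x ^+ k).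
Proof. exact: (holomorphic_onX k (@lb_holo L i j)). Qed.

Fact lbpow_neq0 (L : lineBundle) k (i j : lb_idx L) x :
  lb_dom i x -> lb_dom j x -> lb_trans i j x ^+ k != 0.
Proof. by move=> ix jx; rewrite expf_neq0// lb_neq0. Qed.

Fact lbpow_cocycle (L : lineBundle) m (i j k : lb_idx L) x :
  lb_dom i x -> lb_dom j x -> lb_dom k x ->
  lb_trans i j x ^+ m * lb_trans j k x ^+ m = lb_trans i k x ^+ m.
Proof. by move=> ix jx kx; rewrite -exprMn lb_cocycle. Qed.

Definition lbpow (L : lineBundle) (k : nat) : lineBundle :=
  @LineBundle (lb_idx L) (@lb_dom L) (fun i j x => lb_trans i j x ^+ k)
    (@lb_open L) (@lb_cover L) (@lbpow_holo L k) (@lbpow_neq0 L k)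
    (@lbpow_cocycle L k).

Section Operations.
Variable L : lineBundle.
Implicit Types (c : CC R).

Fact sadd_glue (s t : section L) (i j : lb_idx L) x :
  lb_dom i x -> lb_dom j x ->
  s i x + t i x = lb_trans i j x * (s j x + t j x).
Proof. by move=> ix jx; rewrite (sec_glue s ix jx) (sec_glue t ix jx) mulrDr. Qed.

Definition sadd (s t : section L) : section L :=
  @Section_ L (fun i x => s i x + t i x)
    (fun i => holomorphic_onD (@sec_holo _ s i) (@sec_holo _ t i)) (sadd_glue s t).

Fact sscale_glue c (s : section L) (i j : lb_idx L) x :
  lb_dom i x -> lb_dom j x -> c * s i x = lb_trans i j x * (c * s j x).
Proof. by move=> ix jx; rewrite (sec_glue s ix jx) mulrCA. Qed.

Definition sscale c (s : section L) : section L :=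
  @Section_ L (fun i x => c * s i x)
    (fun i => holomorphic_onM (@holomorphic_on_cst _ c) (@sec_holo _ s i))
    (sscale_glue c s).

Definition ssub (s t : section L) : section L := sadd s (sscale (-1) t).

Fact smul_glue k l (s : section (lbpow L k)) (t : section (lbpow L l))
    (i j : lb_idx L) x :
  lb_dom i x -> lb_dom j x ->
  s i x * t i x = lb_trans i j x ^+ (k + l) * (s j x * t j x).
Proof.
move=> ix jx; rewrite (@sec_glue _ s i j x ix jx) (@sec_glue _ t i j x ix jx) /=.
by rewrite mulrACA exprD.
Qed.

Definition smul k l (s : section (lbpow L k)) (t : section (lbpow L l)) :
    section (lbpow L (k + l)) :=
  @Section_ (lbpow L (k + l)) (fun i x => s i x * t i x)
    (fun i => holomorphic_onM (@sec_holo _ s i) (@sec_holo _ t i)) (@smul_glue k l s t).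

Fact sexp_holo k (s : section (lbpow L k)) m (i : lb_idx L) :
  holomorphic_on (lb_dom i) (fun x => s i x ^+ m).
Proof. exact: (holomorphic_onX m (@sec_holo _ s i)). Qed.

Fact sexp_glue k (s : section (lbpow L k)) m (i j : lb_idx L) x :
  lb_dom i x -> lb_dom j x ->
  s i x ^+ m = lb_trans i j x ^+ (m * k) * s j x ^+ m.
Proof.
by move=> ix jx; rewrite (@sec_glue _ s i j x ix jx) /= exprMn -exprM mulnC.
Qed.

Definition sexp k (s : section (lbpow L k)) m : section (lbpow L (m * k)) :=
  @Section_ (lbpow L (m * k)) (fun i x => s i x ^+ m)
    (sexp_holo s m) (@sexp_glue k s m).

End Operations.
End Bundles.

Declare Scope sec_scope.
Delimit Scope sec_scope with sec.
Bind Scope sec_scope with section.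
Notation "s + t" := (sadd s t) : sec_scope.
Notation "s - t" := (ssub s t) : sec_scope.
Notation "s * t" := (smul s t) : sec_scope.
Notation "c *: s" := (sscale c%R s) : sec_scope.
Notation "s ^+ m" := (sexp s m%N) : sec_scope.

Section Fibrations.
Variables (R : realType) (n : nat) (B : topologicalType).
Variables (M : compactComplexManifold R n B) (L : lineBundle M).

(* Below, the powers of [L] in the stated types agree with those computed by
   the product and the power of sections by conversion on closed naturals. *)
Notation Sec k := (section (lbpow L k)).

(* The coefficients of y^2 = x^4 + e x^2 z^2 + f x z^3 + g z^4. *)
Record E7fibration := E7Fibration { E7e : Sec 2; E7f : Sec 3; E7g : Sec 4 }.

(* The coefficients of the Weierstrass model y^2 + x^3 + F x + G = 0. *)
Definition weierF (X : E7fibration) : Sec 4 :=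
  ((- 4) *: E7g X - (1 / 3) *: (E7e X ^+ 2))%sec.

Definition weierG (X : E7fibration) : Sec 6 :=
  ((- 1) *: (E7f X ^+ 2) + (8 / 3) *: (E7e X * E7g X)
     - (2 / 27) *: (E7e X ^+ 3))%sec.

Definition discr (X : E7fibration) : Sec 12 :=
  (4 *: (weierF X ^+ 3) + 27 *: (weierG X ^+ 2))%sec.

(* e = -2h, f = C phi, g = h^2 + C gamma. *)
Definition E7family (h : Sec 2) (phi : Sec 3) (gamma : Sec 4) (C : CC R) :
    E7fibration :=
  E7Fibration ((- 2) *: h)%sec (C *: phi)%sec (h ^+ 2 + C *: gamma)%sec.

(* [P C] is polynomial in [C], of the form C^m a + O(C^(m+1)), with
   coefficients global sections. *)
Definition expansion (L' : lineBundle M) (P : CC R -> section L') (m : nat)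
    (a : section L') : Prop :=
  exists (N : nat) (r : 'I_N -> section L'),
    forall (C : CC R) i x, lb_dom i x ->
      P C i x = C ^+ m * a i x + \sum_(k < N) C ^+ (m.+1 + k) * r k i x.

Definition leading_term (L' : lineBundle M) (P : CC R -> section L') (m : nat)
    (a : section L') : Prop :=
  sec_nonzero a /\ expansion P m a.

(* Equality s / t = s' / t' of quotients of sections, as meromorphic functions
   on the base: the local value [s i x / t i x] does not depend on the
   trivialization [i]. *)
Definition ratio_eq (k l : nat) (s t : Sec k) (s' t' : Sec l) : Prop :=
  [/\ sec_nonzero t, sec_nonzero t' &
    forall (i : lb_idx L) x, lb_dom i x -> t i x != 0 -> t' i x != 0 ->
      s i x / t i x = s' i x / t' i x].

(* The j-invariant of a one-parameter family is F^3 / Delta up to a nonzero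
   constant; [j_leading X q p t] says that the quotient of the leading terms in
   [C] of F^3 and Delta is, up to a nonzero constant, q(C) p / t. *)
Definition j_leading (X : CC R -> E7fibration) (q : CC R -> CC R)
    (k : nat) (p t : Sec k) : Prop :=
  exists (m m' : nat) (a b : Sec 12),
    [/\ leading_term (fun C => weierF (X C) ^+ 3)%sec m a,
        leading_term (fun C => discr (X C)) m' b &
        exists2 c : CC R, c != 0 &
          forall C : CC R, C != 0 ->
            ratio_eq ((C ^+ m) *: a)%sec ((C ^+ m') *: b)%sec
                     ((c * q C) *: p)%sec t].

End Fibrations.

(* Main.v *)
Require Import Defs.
From HB Require Import structures.
From mathcomp Require Import all_boot all_order all_algebra complex.
From mathcomp Require Import all_classical all_reals all_analysis.
From mathcomp Require Import ring.
Import Order.TTheory GRing.Theory Num.Theory numFieldNormedType.Exports.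
Local Open Scope ring_scope.

(* Substituting the family gives F = -4 (4/3 h^2 + C gamma) and
   G = -(128/27 h^3 + 16/3 C h gamma + C^2 phi^2).  In 4 F^3 + 27 G^2 the terms
   of order 0 and 1 in C cancel, and the term of order 2 is
   -256 h^2 (gamma^2 - phi^2 h); F^3 starts with -4096/27 h^6. *)

Section Expansions.
Variables (R : realType) (n : nat) (B : topologicalType).
Variables (M : compactComplexManifold R n B) (L : lineBundle M).

Lemma sec_nonzero_smul k l (s : section (lbpow L k)) (t : section (lbpow L l)) :
  sec_nonzero (s * t)%sec -> sec_nonzero s /\ sec_nonzero t.
Proof.
move=> [i [x [ix]]] /=; rewrite mulf_eq0 negb_or => /andP[s0 t0].
by split; exists i, x.
Qed.

(** At a point where a positive power is nonzero, [s] itself is nonzero. Positivity matters, as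
    [s ^+ 0] is the constant 1. This carries nonvanishing from [h ^+ 2] to [h ^+ 6]. *)
Lemma sec_nonzero_sexp k (s : section (lbpow L k)) m m' :
  sec_nonzero (s ^+ m.+1)%sec -> sec_nonzero (s ^+ m')%sec.
Proof.
move=> [i [x [ix]]] /=; rewrite expf_eq0 /= => s0.
by exists i, x; split=> //=; rewrite expf_neq0.
Qed.

Lemma sec_nonzero_sscale (L' : lineBundle M) (c : CC R) (s : section L') :
  c != 0 -> sec_nonzero s -> sec_nonzero (c *: s)%sec.
Proof.
by move=> c0 [i [x [ix s0]]]; exists i, x; split=> //=; rewrite mulf_neq0.
Qed.

Variables (h : section (lbpow L 2)) (phi : section (lbpow L 3))
  (gamma : section (lbpow L 4)).

Lemma discr_E7family_expansion :
  expansion (fun C => discr (E7family h phi gamma C)) 2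
    ((- 256) *: (h ^+ 2 * (gamma ^+ 2 - phi ^+ 2 * h) : section (lbpow L 12)))%sec.
Proof.
(* Coefficients of C^3 and C^4: -256 gamma^3 comes from 4 F^3, 288 h gamma phi^2 from the cross term
   of 27 G^2, and 27 phi^4 from the square of C^2 phi^2. *)
pose r0 : section (lbpow L 12) :=
  ((- 256) *: (gamma ^+ 3) + 288 *: (h * (gamma * phi ^+ 2)))%sec.
pose r1 : section (lbpow L 12) := (27 *: (phi ^+ 4))%sec.
(* Index k stands for C^(3 + k); as k < 2, the default of [nth] is never reached. *)
exists 2%N, (fun k => nth r0 [:: r0; r1] k) => C i x ix.
rewrite !big_ord_recl big_ord0 /=.
by field.
Qed.

Lemma weierF3_E7family_expansion :
  expansion (fun C => weierF (E7family h phi gamma C) ^+ 3)%sec 0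
    ((- (4096 / 27)) *: (h ^+ 6) : section (lbpow L 12))%sec.
Proof.
(* Binomial coefficients of -64 (4/3 h^2 + C gamma)^3 at C, C^2 and C^3. *)
pose r0 : section (lbpow L 12) := ((- (1024 / 3)) *: (h ^+ 4 * gamma))%sec.
pose r1 : section (lbpow L 12) := ((- 256) *: (h ^+ 2 * gamma ^+ 2))%sec.
pose r2 : section (lbpow L 12) := ((- 64) *: (gamma ^+ 3))%sec.
exists 3%N, (fun k => nth r0 [:: r0; r1; r2] k) => C i x ix.
rewrite !big_ord_recl big_ord0 /=.
by field.
Qed.

End Expansions.

Theorem mainTheorem12 (R : realType) (n : nat) (B : topologicalType)
    (M : compactComplexManifold R n B) (L : lineBundle M)
    (h : section (lbpow L 2)) (phi : section (lbpow L 3))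
    (gamma : section (lbpow L 4)) :
  let D : section (lbpow L 8) := (gamma ^+ 2 - phi ^+ 2 * h)%sec in
  let A : section (lbpow L 12) := (h ^+ 2 * D)%sec in
  let X := E7family h phi gamma in
  (exists2 c : CC R, c != 0 &
     expansion (fun C => discr (X C)) 2 (c *: A)%sec) /\
  (sec_nonzero A -> j_leading X (fun C => 1 / C ^+ 2) (h ^+ 4)%sec D).
Proof.
move=> D A X.
have c0 : - 256 != 0 :> CC R by rewrite oppr_eq0 pnatr_eq0.
split; first by exists (- 256) => //; exact: discr_E7family_expansion.
(* Generality of the sections enters as [sec_nonzero A]. The weights 4 and 8 let 12 be read as 4 + 8
   by conversion; [h0] concerns [h ^+ 2], not [h]. *)
move=> A0; have [h0 D0] := @sec_nonzero_smul _ _ _ _ _ 4 8 _ _ A0.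
have cA0 : sec_nonzero ((- 256) *: A)%sec by exact: sec_nonzero_sscale.
exists 0%N, 2%N, ((- (4096 / 27)) *: (h ^+ 6))%sec, ((- 256) *: A)%sec; split.
- split; last exact: weierF3_E7family_expansion.
  apply: sec_nonzero_sscale; last exact: (@sec_nonzero_sexp _ _ _ _ _ 2 h 1 6 h0).
  by rewrite oppr_eq0 mulf_neq0 ?invr_eq0 ?pnatr_eq0.
- by split; last exact: discr_E7family_expansion.
(* 16/27 is the quotient of -4096/27 by -256. *)
exists (16 / 27); first by rewrite mulf_neq0 ?invr_eq0 ?pnatr_eq0.
move=> C C0; split=> //.
  by apply: sec_nonzero_sscale => //; rewrite expf_neq0.
move=> i x ix t0 D0x.
(* The denominator C^2 (-256) h^2 D is nonzero at x, so h^2 cancels there and h^6 / (h^2 D) becomes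
   h^4 / D. *)
have hx0 : h i x != 0.
  by apply: contra_neq t0 => /= ->; rewrite expr0n /= mul0r !mulr0.
move: D0x => /= D0x.
by field; rewrite D0x C0 hx0.
Qed.
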